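(* Let $f_k = s_k + g_k$, $k \ge 0$, be the time-varying cost functions on $\mathbb{R}^{ln+lm}$ defined in the context, where for each $k$ the gradient of $s_k$ is $L_k$-Lipschitz continuous, and suppose that $L := \max_k\{L_k\}$ exists (and is finite). Let $\mathcal{X} = \mathcal{H} \times \mathcal{M}$ be the constraint set, let $\mathbf{x}_k^*$ be a minimizer of $f_k$ for each $k \ge 0$, and let $\{\mathbf{x}_k\}_{k\ge 0}$ be the sequence generated from an initial point $\mathbf{x}_0 \in \mathcal{X}$ by the online proximal-gradient algorithm $$\mathbf{y}_k = \mathbf{x}_{k-1} - \alpha \nabla s_k(\mathbf{x}_{k-1}), \qquad \mathbf{x}_k = \operatorname{prox}^{\alpha}_{g_k}\{\mathbf{y}_k\}, \qquad k = 1, 2, \dots,$$ with a constant step size $\alpha > 0$. Define $$\mathrm{Reg}_k := \sum_{i=1}^k \left[ f_i(\mathbf{x}_i) - f_i(\mathbf{x}_i^* ) \right], \quad \omega_k := \|\mathbf{x}_k^* - \mathbf{x}_{k-1}^*\|, \quad \Omega_k := \sum_{i=1}^k \omega_i, \quad \bar{\Omega}_k := \sum_{i=1}^k \omega_i^2 .$$ If $\alpha \le 1/L$, then $$\frac{1}{k}\,\mathrm{Reg}_k = \mathcal{O}\left(1 + k^{-1}\Omega_k + k^{-1}\bar{\Omega}_k\right) \quad \text{as } k \to \infty .$$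
   Context: Fix positive integers $l, n, m$. Data vectors $\Delta\mathbf{f}_j \in \mathbb{R}^l$ and $\Delta\mathbf{p}_j \in \mathbb{R}^n$ (for integers $j \ge -m+1$) are arbitrary given measurements, and over a sliding window of length $m$ one forms $$\Delta\mathbf{F}_k = [\Delta\mathbf{f}_{k-m+1}\ \cdots\ \Delta\mathbf{f}_k] \in \mathbb{R}^{l\times m}, \qquad \Delta\mathbf{P}_k = [\Delta\mathbf{p}_{k-m+1}\ \cdots\ \Delta\mathbf{p}_k] \in \mathbb{R}^{n\times m}, \qquad k \ge 0.$$ The set $\mathcal{H} \subset \mathbb{R}^{l\times n}$ is a nonempty compact convex set (e.g. all matrices with entries in $[h_{\min},h_{\max}]$), and $\mathcal{M} \subset \mathbb{R}^{l\times m}$ is the set of matrices with all entries in a given interval $[o_{\min}, o_{\max}]$, $o_{\min}\le o_{\max}$. Regularization parameters $\lambda_k > 0$, $\gamma_k > 0$ are given for each $k$. A pair $(\mathbf{H},\mathbf{O}) \in \mathbb{R}^{l\times n}\times\mathbb{R}^{l\times m}$ is identified with the stacked vector $\mathbf{x} = [\mathrm{vec}(\mathbf{H})^\top, \mathrm{vec}(\mathbf{O})^\top]^\top \in \mathbb{R}^{ln+lm}$, where $\mathrm{vec}$ stacks columns; under this identification $\mathcal{X} = \mathcal{H}\times\mathcal{M} \subset \mathbb{R}^{ln+lm}$. The norm $\|\cdot\|$ is the Euclidean norm. For each $k$ define $$s_k(\mathbf{x}) = \|\Delta\mathbf{F}_k - \mathbf{H}\,\Delta\mathbf{P}_k - \mathbf{O}\|_F^2,$$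 $$g_k(\mathbf{x}) = \lambda_k \|\mathbf{H}\|_* + \gamma_k \|\mathrm{vec}(\mathbf{O})\|_1 + \iota_{\mathcal{H}}(\mathbf{H}) + \iota_{\mathcal{M}}(\mathbf{O}),$$ $$f_k(\mathbf{x}) = s_k(\mathbf{x}) + g_k(\mathbf{x}),$$ where $\|\cdot\|_F$ is the Frobenius norm, $\|\cdot\|_*$ the nuclear norm (sum of singular values), $\|\cdot\|_1$ the $\ell_1$-norm, and $\iota_C$ is the indicator function of a set $C$ ($0$ on $C$, $+\infty$ off $C$). The proximal operator is $$\operatorname{prox}^{\alpha}_{g}\{\mathbf{y}\} := \arg\min_{\mathbf{x}} \left\{ g(\mathbf{x}) + \frac{1}{2\alpha}\|\mathbf{x}-\mathbf{y}\|^2 \right\}.$$ For two sequences $\{a_k\}$, $\{b_k\}$ with $b_k>0$, $a_k = \mathcal{O}(b_k)$ means $\limsup_{k\to\infty} (a_k/b_k) < \infty$. *)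

(* Defs.v *)
From HB Require Import structures.
From mathcomp Require Import all_boot all_order all_algebra.
From mathcomp Require Import all_classical all_reals all_analysis.
From mathcomp Require polyrcf.
Set Implicit Arguments.
Unset Strict Implicit.
Unset Printing Implicit Defensive.
Import Order.TTheory GRing.Theory Num.Theory.
Import numFieldNormedType.Exports.
Local Open Scope classical_set_scope.
Local Open Scope ring_scope.

(* The library norm on matrices is the sup norm; it induces the topology used
   for compactness and derivatives, but the norms below are defined by hand. *)
Definition norm2 (R : realType) (d : nat) (v : 'cV[R]_d) : R :=
  Num.sqrt (\sum_i v i 0 ^+ 2).

Definition norm1 (R : realType) (d : nat) (v : 'cV[R]_d) : R :=
  \sum_i `|v i 0|.

Definition frobenius (R : realType) (p q : nat) (A : 'M[R]_(p, q)) : R :=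
  Num.sqrt (\sum_i \sum_j A i j ^+ 2).

(* Square roots of the eigenvalues of A^T A, each repeated according to its
   algebraic multiplicity. There are q of them instead of min(p, q); when
   q > p the extra ones vanish. *)
Definition singular_values (R : realType) (p q : nat) (A : 'M[R]_(p, q)) :
    seq R :=
  let chi := char_poly (A^T *m A) in
  flatten [seq nseq (mup a chi) (Num.sqrt a) | a <- polyrcf.rootsR chi].

Definition nuclear (R : realType) (p q : nat) (A : 'M[R]_(p, q)) : R :=
  \sum_(s <- singular_values A) s.

(* mxvec concatenates rows, so the transposes make vec stack columns. *)
Definition vec (R : realType) (p q : nat) (A : 'M[R]_(p, q)) : 'cV[R]_(q * p) :=
  (mxvec A^T)^T.

Definition unvec (R : realType) (p q : nat) (v : 'cV[R]_(q * p)) :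
    'M[R]_(p, q) :=
  (vec_mx v^T)^T.

Definition stack (R : realType) (l n m : nat) (H : 'M[R]_(l, n))
    (O : 'M[R]_(l, m)) : 'cV[R]_(n * l + m * l) :=
  col_mx (vec H) (vec O).

Definition Hpart (R : realType) (l n m : nat) (x : 'cV[R]_(n * l + m * l)) :
    'M[R]_(l, n) :=
  unvec (usubmx x).

Definition Opart (R : realType) (l n m : nat) (x : 'cV[R]_(n * l + m * l)) :
    'M[R]_(l, m) :=
  unvec (dsubmx x).

Lemma vecK (R : realType) (p q : nat) : cancel (@vec R p q) (@unvec R p q).
Proof. by move=> A; rewrite /unvec /vec trmxK mxvecK trmxK. Qed.

Lemma unvecK (R : realType) (p q : nat) : cancel (@unvec R p q) (@vec R p q).
Proof. by move=> v; rewrite /unvec /vec trmxK vec_mxK trmxK. Qed.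

Lemma stackK (R : realType) (l n m : nat) (x : 'cV[R]_(n * l + m * l)) :
  stack (Hpart x) (Opart x) = x.
Proof. by rewrite /stack !unvecK vsubmxK. Qed.

Lemma Hpart_stack (R : realType) (l n m : nat) (H : 'M[R]_(l, n))
  (O : 'M[R]_(l, m)) : Hpart (stack H O) = H.
Proof. by rewrite /Hpart col_mxKu vecK. Qed.

Lemma Opart_stack (R : realType) (l n m : nat) (H : 'M[R]_(l, n))
  (O : 'M[R]_(l, m)) : Opart (stack H O) = O.
Proof. by rewrite /Opart col_mxKd vecK. Qed.

Definition window (R : realType) (d : nat) (u : int -> 'cV[R]_d) (m k : nat) :
    'M[R]_(d, m) :=
  \matrix_(i < d, j < m) u (k%:Z - m%:Z + 1 + (j : nat)%:Z) i 0.

Definition box (R : realType) (p q : nat) (a b : R) : set 'M[R]_(p, q) :=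
  [set A | forall i j, a <= A i j <= b].

Definition constraint_set (R : realType) (l n m : nat) (Hs : set 'M[R]_(l, n))
    (Ms : set 'M[R]_(l, m)) : set 'cV[R]_(n * l + m * l) :=
  [set x | Hs (Hpart x) /\ Ms (Opart x)].

Definition indicator_fun (R : realType) (T : Type) (C : set T) (x : T) :
    \bar R :=
  if `[< C x >] then 0%E else +oo%E.

Definition smooth_cost (R : realType) (l n m : nat) (F : 'M[R]_(l, m))
    (P : 'M[R]_(n, m)) (x : 'cV[R]_(n * l + m * l)) : R :=
  frobenius (F - Hpart x *m P - Opart x) ^+ 2.

Definition nonsmooth_cost (R : realType) (l n m : nat) (lam gam : R)
    (Hs : set 'M[R]_(l, n)) (Ms : set 'M[R]_(l, m))
    (x : 'cV[R]_(n * l + m * l)) : \bar R :=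
  ((lam * nuclear (Hpart x) + gam * norm1 (vec (Opart x)))%:E
   + indicator_fun R Hs (Hpart x) + indicator_fun R Ms (Opart x))%E.

Definition gradient (R : realType) (d : nat) (h : 'cV[R]_d -> R)
    (x : 'cV[R]_d) : 'cV[R]_d :=
  \col_(i < d) 'D_(delta_mx i 0) h x.

Definition lipschitz2 (R : realType) (d : nat) (c : R)
    (G : 'cV[R]_d -> 'cV[R]_d) : Prop :=
  forall x y, norm2 (G x - G y) <= c * norm2 (x - y).

Definition argmin (R : realType) (T : Type) (h : T -> \bar R) : set T :=
  [set x | forall z, (h x <= h z)%E].

(* A set; it is a singleton when g is proper, convex and lower
   semicontinuous. *)
Definition prox (R : realType) (d : nat) (alpha : R) (g : 'cV[R]_d -> \bar R)
    (y : 'cV[R]_d) : set 'cV[R]_d :=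
  argmin (fun x => g x + (1 / (2 * alpha) * norm2 (x - y) ^+ 2)%:E)%E.

Definition regret (R : realType) (T : Type) (f : nat -> T -> \bar R)
    (x xstar : nat -> T) (k : nat) : \bar R :=
  (\sum_(1 <= i < k.+1) (f i (x i) - f i (xstar i)))%E.

(* The displacement norm2 (xstar k - xstar k.-1), meant for k >= 1. *)
Definition drift (R : realType) (d : nat) (xstar : nat -> 'cV[R]_d) (k : nat) :
    R :=
  norm2 (xstar k - xstar k.-1).

Definition bigO_seq (R : realType) (a : nat -> \bar R) (b : nat -> R) : Prop :=
  (limn_esup (fun k => a k * (b k)^-1%:E) < +oo)%E.

(* Main.v *)
Require Import Defs.
From HB Require Import structures.
From mathcomp Require Import all_boot all_order all_algebra.
From mathcomp Require Import all_classical all_reals all_analysis.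
From mathcomp Require Import ring lra.
Set Implicit Arguments.
Unset Strict Implicit.
Unset Printing Implicit Defensive.
Import Order.TTheory GRing.Theory Num.Theory.
Import numFieldNormedType.Exports.
Local Open Scope classical_set_scope.
Local Open Scope ring_scope.

(* The term 1 in the O-bound already dominates: the average regret is bounded.
   Let z be the minimiser of f_k. Comparing x_k with z in the minimisation
   that defines the proximal point, and using the descent lemma
   (alpha <= 1/L) together with the convexity of the quadratic s_k, gives
     f_k(x_k) - f_k(z) <= |z - x_(k-1)|^2 / (2 alpha),
   which is at most diam(X)^2 / (2 alpha) since all iterates and minimisers
   lie in the bounded set X. The nuclear norm enters only through being
   real-valued. *)

(** * Frobenius inner product, which for one column is the Euclidean one *)

Section FrobeniusProduct.
Variables (R : realType) (p q : nat).
Implicit Types A B C : 'M[R]_(p, q).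

(** In trace form, bilinearity and symmetry come directly from matrix algebra. *)
Definition dotmx A B : R := \tr (A *m B^T).

Lemma dotmxE A B : dotmx A B = \sum_i \sum_j A i j * B i j.
Proof.
by apply: eq_bigr => i _; rewrite mxE; apply: eq_bigr => j _; rewrite mxE.
Qed.

Lemma dotmxC A B : dotmx A B = dotmx B A.
Proof. by rewrite /dotmx -mxtrace_tr trmx_mul trmxK. Qed.

Lemma dotmxDl A B C : dotmx (A + B) C = dotmx A C + dotmx B C.
Proof. by rewrite /dotmx mulmxDl mxtraceD. Qed.

Lemma dotmxZl (t : R) A B : dotmx (t *: A) B = t * dotmx A B.
Proof. by rewrite /dotmx -scalemxAl mxtraceZ. Qed.

Lemma dotmxNl A B : dotmx (- A) B = - dotmx A B.
Proof. by rewrite -scaleN1r dotmxZl mulN1r. Qed.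

Lemma dotmxDr A B C : dotmx A (B + C) = dotmx A B + dotmx A C.
Proof. by rewrite 3!(dotmxC A) dotmxDl. Qed.

Lemma dotmxZr (t : R) A B : dotmx A (t *: B) = t * dotmx A B.
Proof. by rewrite 2!(dotmxC A) dotmxZl. Qed.

Lemma dotmxNr A B : dotmx A (- B) = - dotmx A B.
Proof. by rewrite 2!(dotmxC A) dotmxNl. Qed.

Lemma dotmx_ge0 A : 0 <= dotmx A A.
Proof.
by rewrite dotmxE; do 2![apply: sumr_ge0 => ? _]; rewrite -expr2 sqr_ge0.
Qed.

Lemma sqr_frobenius A : frobenius A ^+ 2 = dotmx A A.
Proof.
by rewrite sqr_sqrtr ?dotmxE//; do 2![apply: sumr_ge0 => ? _]; exact: sqr_ge0.
Qed.

End FrobeniusProduct.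

Lemma dot_colE (R : realType) (d : nat) (u v : 'cV[R]_d) :
  dotmx u v = \sum_i u i 0 * v i 0.
Proof. by rewrite dotmxE; apply: eq_bigr => i _; rewrite big_ord1. Qed.

Lemma sqr_norm2 (R : realType) (d : nat) (v : 'cV[R]_d) :
  norm2 v ^+ 2 = dotmx v v.
Proof.
by rewrite sqr_sqrtr ?dot_colE//; apply: sumr_ge0 => i _; exact: sqr_ge0.
Qed.

Lemma norm2_ge0 (R : realType) (d : nat) (v : 'cV[R]_d) : 0 <= norm2 v.
Proof. exact: sqrtr_ge0. Qed.

(** * Quadratic costs and one proximal-gradient step *)

Lemma derive_quadratic (R : realType) (d : nat) (h : 'cV[R]_d -> R)
    (x v : 'cV[R]_d) (b c : R) :
  (forall t, h (t *: v + x) = h x + t * b + t ^+ 2 * c) -> 'D_v h x = b.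
Proof.
move=> hE; rewrite /derive; apply: cvg_lim => //.
(* For [t != 0] the difference quotient is exactly [b + t * c]. *)
have H : (b + t * c) @[t --> 0^'] --> b + 0 * c.
  apply: cvgD; first exact: cvg_cst.
  apply: cvgM; last exact: cvg_cst.
  exact: nbhs_dnbhs.
rewrite mul0r addr0 in H.
apply: cvg_trans H; apply: near_eq_cvg.
near=> t.
have t0 : t != 0 by near: t; exact: nbhs_dnbhs_neq.
rewrite /= hE /GRing.scale /=; field.
by [].
Unshelve. all: by end_near. Qed.

Section LeastSquares.
Variables (R : realType) (d p q : nat) (B : 'M[R]_(p, q)).
Variable A : {linear 'cV[R]_d -> 'M[R]_(p, q)}.

Let s (x : 'cV[R]_d) : R := dotmx (B - A x) (B - A x).

Lemma least_squares_expand (x v : 'cV[R]_d) :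
  s (x + v) = s x - 2 * dotmx (B - A x) (A v) + dotmx (A v) (A v).
Proof.
rewrite /s linearD opprD addrA.
move: (B - A x) (A v) => r w.
by rewrite !(dotmxDl, dotmxDr, dotmxNl, dotmxNr) (dotmxC w r); ring.
Qed.

(** The gradient is -2 A^*(B - A x); pairing it with [v] avoids introducing the adjoint of [A]. *)
Lemma gradient_least_squares (x v : 'cV[R]_d) :
  dotmx (gradient s x) v = - 2 * dotmx (B - A x) (A v).
Proof.
have AZ t w : A (t *: w) = t *: A w by rewrite linearZ.
have -> : gradient s x =
    \col_i (- 2 * dotmx (B - A x) (A (delta_mx i 0))).
  apply/matrixP => i j; rewrite !mxE.
  apply: (@derive_quadratic _ _ _ _ _ _
    (dotmx (A (delta_mx i 0)) (A (delta_mx i 0)))) => t.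
  by rewrite addrC least_squares_expand AZ dotmxZl !dotmxZr; ring.
rewrite dot_colE; move: (B - A x) => r.
have {2}-> : v = \sum_i v i 0 *: delta_mx i 0.
  by rewrite {1}[v]matrix_sum_delta; apply: eq_bigr => i _; rewrite big_ord1.
rewrite linear_sum dotmxC {2}/dotmx mulmx_suml raddf_sum mulr_sumr.
apply: eq_bigr => i _; rewrite mxE AZ /= -/(dotmx _ _) dotmxZl dotmxC.
by ring.
Qed.

(** This expansion is exact. Its last term is nonnegative, which gives convexity; bounding it above
    gives the descent lemma. *)
Lemma least_squares_taylor (x v : 'cV[R]_d) :
  s (x + v) = s x + dotmx (gradient s x) v + dotmx (A v) (A v).
Proof. by rewrite least_squares_expand gradient_least_squares mulNr. Qed.

(** The Hessian is 2 A^* A, so the gradient difference [w] between [v] and 0 satisfies <w, v> = 2 |A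
    v|^2, while |w| <= L |v|. *)
Lemma least_squares_curvature (L : R) (v : 'cV[R]_d) : 0 < L ->
  lipschitz2 L (gradient s) -> 2 * dotmx (A v) (A v) <= L * dotmx v v.
Proof.
move=> L0 sL.
set w := gradient s v - gradient s 0.
have wv : dotmx w v = 2 * dotmx (A v) (A v).
  rewrite dotmxDl dotmxNl !gradient_least_squares linear0 subr0.
  by rewrite !dotmxDl dotmxNl; ring.
have ww : dotmx w w <= L ^+ 2 * dotmx v v.
  have := sL v 0; rewrite subr0 -/w => wL.
  rewrite -!sqr_norm2 -exprMn lerXn2r// nnegrE ?norm2_ge0//.
  by rewrite mulr_ge0 ?norm2_ge0// ltW.
(* AM-GM replaces Cauchy-Schwarz: 2 L <w, v> <= |w|^2 + L^2 |v|^2. *)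
move: w wv ww => w wv ww; have := dotmx_ge0 (w - L *: v).
rewrite !(dotmxDl, dotmxDr, dotmxNl, dotmxNr, dotmxZl, dotmxZr) (dotmxC v w).
rewrite wv => H; rewrite -(ler_pM2l L0); nra.
Qed.

(** Expand both squared distances around [x]: the gradient terms cancel against the linear terms of
    the expansions of [s]. What remains of |u - x|^2 / (2 alpha) absorbs |A (u - x)|^2 because L <=
    1 / alpha, and |A (z - x)|^2 is dropped. *)
Lemma proximal_gradient_step (L alpha gu gz : R) (x u z : 'cV[R]_d) :
  lipschitz2 L (gradient s) -> 0 < alpha -> alpha <= 1 / L ->
  let y := x - alpha *: gradient s x in
  gu + 1 / (2 * alpha) * norm2 (u - y) ^+ 2 <=
    gz + 1 / (2 * alpha) * norm2 (z - y) ^+ 2 ->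
  s u + gu <= s z + gz + 1 / (2 * alpha) * norm2 (z - x) ^+ 2.
Proof.
move=> sL alpha0 alphaL y.
(* Positivity of [L] is forced by [0 < alpha <= 1 / L], also under the convention 1 / 0 = 0. *)
have L0 : 0 < L by have := lt_le_trans alpha0 alphaL; rewrite div1r invr_gt0.
have a0 : alpha != 0 by rewrite gt_eqF.
have suE := least_squares_taylor x (u - x).
have szE := least_squares_taylor x (z - x).
rewrite !(addrC x) !subrK in suE szE.
have curv := least_squares_curvature (u - x) L0 sL.
have sz0 := dotmx_ge0 (A (z - x)).
have yE v : v - y = (v - x) + alpha *: gradient s x.
  by rewrite /y opprB addrA addrAC.
have La : L <= alpha^-1 by rewrite -[L]invrK lef_pV2 ?posrE ?invr_gt0// -div1r.
have cu := ler_wpM2r (dotmx_ge0 (u - x)) La.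
rewrite suE szE !yE !sqr_norm2.
move: (u - x) (z - x) (gradient s x) curv sz0 cu => w v G curv sz0 cu.
rewrite !(dotmxDl, dotmxDr, dotmxZl, dotmxZr) (dotmxC w G) (dotmxC v G).
have expand e t b : 1 / (2 * alpha) *
    (e + alpha * t + alpha * (t + alpha * b)) =
    alpha^-1 * e / 2 + t + alpha * b / 2 by field.
rewrite !expand div1r invfM; lra.
Qed.

End LeastSquares.

(** * The fitting cost as a least-squares cost in the stacked variable *)

Section Measurement.
Variables (R : realType) (l n m : nat) (P : 'M[R]_(n, m)).

Definition predict (x : 'cV[R]_(n * l + m * l)) : 'M[R]_(l, m) :=
  Hpart x *m P + Opart x.

Lemma predict_is_linear : linear predict.
Proof.
move=> a x y; rewrite /predict /Hpart /Opart /unvec !linearP/= mulmxDl.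
by rewrite -scalemxAl scalerDr addrACA.
Qed.

HB.instance Definition _ :=
  GRing.isLinear.Build R _ _ _ predict predict_is_linear.

Lemma smooth_costE (F : 'M[R]_(l, m)) :
  smooth_cost F P = fun x => dotmx (F - predict x) (F - predict x).
Proof.
by apply/funext => x; rewrite /smooth_cost sqr_frobenius /predict opprD addrA.
Qed.

End Measurement.

(** * Boundedness of the constraint set *)

Lemma compact_entry_bounded (R : realType) (p q : nat) (K : set 'M[R]_(p, q)) :
  compact K -> exists b, forall A, K A -> forall i j, `|A i j| <= b.
Proof.
move=> Kc; have [b [_ Kb]] := compact_bounded Kc.
(* [compact_bounded] provides the bound only for numbers strictly above [b]. *)
exists (b + 1) => A KA i j.
apply: le_trans (Kb _ _ _ KA); last by rewrite ltrDl.
rewrite /Num.norm/= mx_normrE; exact: (le_bigmax _ _ (i, j)).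
Qed.

Lemma vec_entry (R : realType) (p q : nat) (A : 'M[R]_(p, q)) i :
  exists r c, vec A i 0 = A r c.
Proof.
rewrite /vec mxE; case/mxvec_indexP: i => c r.
by exists r, c; rewrite mxvecE mxE.
Qed.

Lemma constraint_set_bounded (R : realType) (l n m : nat)
    (Hs : set 'M[R]_(l, n)) (omin omax : R) : compact Hs ->
  exists D, forall u v : 'cV[R]_(n * l + m * l),
    constraint_set Hs (box omin omax) u ->
    constraint_set Hs (box omin omax) v ->
    norm2 (u - v) ^+ 2 <= D.
Proof.
move=> /compact_entry_bounded[b Hb].
(* One bound for all coordinates: [b] serves the block of H, the interval endpoints serve that of
   O. *)
pose c := Num.max b (Num.max `|omin| `|omax|).
have entry (u : 'cV[R]_(n * l + m * l)) i :
    constraint_set Hs (box omin omax) u -> `|u i 0| <= c.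
  move=> [uH uO]; rewrite -(stackK u) /stack mxE.
  case: (fintype.split i) => k.
    have [r [e ->]] := vec_entry (Hpart u) k.
    by apply: le_trans (Hb _ uH r e) _; rewrite le_max lexx.
  have [r [e ->]] := vec_entry (Opart u) k.
  have /andP[lo hi] := uO r e.
  rewrite !le_max; apply/orP; right.
  case: (ger0P (Opart u r e)) => _.
    by rewrite (le_trans hi (ler_norm _)) orbT.
  by rewrite (@le_trans _ _ (- omin)) ?lerN2// -normrN ler_norm.
exists (\sum_(i < n * l + m * l) (2 * c) ^+ 2) => u v Xu Xv.
rewrite sqr_norm2 dot_colE; apply: ler_sum => i _.
have := entry u i Xu; have := entry v i Xv; rewrite !mxE -expr2 => vc uc.
rewrite -real_normK ?num_real// lerXn2r ?nnegrE//.
  by rewrite mulr_ge0 ?(le_trans _ uc).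
by apply: le_trans (ler_normB _ _) _; rewrite mulr_natl lerD.
Qed.

(** * Finiteness of the nonsmooth cost and feasibility of minimisers *)

Section NonsmoothCost.
Variables (R : realType) (l n m : nat) (lam gam : R).
Variables (Hs : set 'M[R]_(l, n)) (Ms : set 'M[R]_(l, m)).

Definition regularizer (x : 'cV[R]_(n * l + m * l)) : R :=
  lam * nuclear (Hpart x) + gam * norm1 (vec (Opart x)).

Lemma nonsmooth_cost_in x : constraint_set Hs Ms x ->
  nonsmooth_cost lam gam Hs Ms x = (regularizer x)%:E.
Proof.
by move=> [xH xO]; rewrite /nonsmooth_cost /indicator_fun !asboolT// !adde0.
Qed.

Lemma nonsmooth_cost_out x : ~ constraint_set Hs Ms x ->
  nonsmooth_cost lam gam Hs Ms x = +oo%E.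
Proof.
move=> /not_andP[] xN; rewrite /nonsmooth_cost /indicator_fun (asboolF xN).
  by case: ifP.
by case: ifP.
Qed.

Lemma argmin_in_constraint_set (h : 'cV[R]_(n * l + m * l) -> R) x z :
  constraint_set Hs Ms z ->
  argmin (fun v => nonsmooth_cost lam gam Hs Ms v + (h v)%:E)%E x ->
  constraint_set Hs Ms x.
Proof.
move=> Xz xmin; apply: contrapT => Xx; have := xmin z.
by rewrite nonsmooth_cost_out// nonsmooth_cost_in// addye// leye_eq.
Qed.

End NonsmoothCost.

(** * From a uniform bound to the O-estimate *)

Lemma bounded_bigO_seq (R : realType) (a : nat -> \bar R) (b : nat -> R)
    (C : R) :
  (forall k, a k <= C%:E)%E -> 0 <= C -> (forall k, 1 <= b k) -> bigO_seq a b.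
Proof.
move=> aC C0 b1; apply: (@le_lt_trans _ _ C%:E); last exact: ltry.
(* The limsup is an infimum of suprema; the supremum over all indices is one of them. *)
apply: ge_ereal_inf; exists (ereal_sup [set (a k * (b k)^-1%:E)%E | k in setT]).
  by exists setT => //; exact: filterT.
apply: ge_ereal_sup => _ [k _ <-].
have bk0 : 0 < b k := lt_le_trans ltr01 (b1 k).
apply: (@le_trans _ _ (C%:E * (b k)^-1%:E)%E).
  by apply: lee_wpmul2r => //; rewrite lee_fin invr_ge0 ltW.
by rewrite -EFinM lee_fin ler_pdivrMr// ler_peMr.
Qed.

Theorem theorem1 (R : realType) (l n m : nat)
    (hl : (0 < l)%N) (hn : (0 < n)%N) (hm : (0 < m)%N)
    (df : int -> 'cV[R]_l) (dp : int -> 'cV[R]_n)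
    (Hs : set 'M[R]_(l, n)) (Hs0 : Hs !=set0) (Hs_compact : compact Hs)
    (Hs_convex : convex_set Hs)
    (omin omax : R) (ho : omin <= omax)
    (lam gam : nat -> R) (hlam : forall k, 0 < lam k)
    (hgam : forall k, 0 < gam k)
    (Lk : nat -> R) (L alpha : R)
    (x y xstar : nat -> 'cV[R]_(n * l + m * l)) :
  let Ms : set 'M[R]_(l, m) := box omin omax in
  let X := constraint_set Hs Ms in
  let s := fun k => smooth_cost (window df m k) (window dp m k) in
  let g := fun k => nonsmooth_cost (lam k) (gam k) Hs Ms in
  let f := fun k z => ((s k z)%:E + g k z)%E in
  let Omega := fun k => \sum_(1 <= i < k.+1) drift xstar i in
  let Omegabar := fun k => \sum_(1 <= i < k.+1) drift xstar i ^+ 2 in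
  (forall k, lipschitz2 (Lk k) (gradient (s k))) ->
  (exists k, Lk k = L) /\ (forall k, Lk k <= L) ->
  (forall k, argmin (f k) (xstar k)) ->
  X (x 0%N) ->
  (forall k, (1 <= k)%N ->
     y k = x k.-1 - alpha *: gradient (s k) (x k.-1) /\
     prox alpha (g k) (y k) (x k)) ->
  0 < alpha ->
  alpha <= 1 / L ->
  bigO_seq (fun k => (k%:R^-1)%:E * regret f x xstar k)%E
    (fun k => 1 + k%:R^-1 * Omega k + k%:R^-1 * Omegabar k).
Proof.
move=> Ms X s g f Omega Omegabar sLip [_ LkL] xsmin Xx0 xstep alpha0 alphaL.
have [H0 Hs0H] := Hs0.
(* A feasible competitor, needed to show that the minimisers [xstar k] are feasible. *)
have X0 : X (stack H0 (const_mx omin)).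
  split; first by rewrite Hpart_stack.
  by rewrite Opart_stack => i j; rewrite mxE lexx.
have Xxs k : X (xstar k).
  apply: (@argmin_in_constraint_set _ _ _ _ (lam k) (gam k) _ _ (s k)) X0 _.
  by move=> z; have := xsmin k z; rewrite /f ![((s k _)%:E + _)%E]addeC.
have Xx k : X (x k).
  case: k => [//|k]; have [_ xmin] := xstep k.+1 isT.
  exact: argmin_in_constraint_set (Xxs k.+1) xmin.
have sL k : lipschitz2 L (gradient (s k)).
  move=> u v; apply: le_trans (sLip k u v) _.
  by apply: ler_wpM2r (LkL k); exact: norm2_ge0.
have [D XD] := constraint_set_bounded m omin omax Hs_compact.
have D0 : 0 <= D by apply: le_trans (XD _ _ X0 X0); exact: sqr_ge0.
pose C := 1 / (2 * alpha) * D.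
have a0 : 0 <= 1 / (2 * alpha) by rewrite divr_ge0// mulr_ge0// ltW.
have C0 : 0 <= C by rewrite mulr_ge0.
have step k : (1 <= k)%N -> (f k (x k) - f k (xstar k) <= C%:E)%E.
  move=> k1; have [yE xmin] := xstep k k1.
  have := xmin (xstar k).
  (* Feasibility of both points turns the extended-real inequalities into real ones. *)
  rewrite /f /g (nonsmooth_cost_in _ _ (Xx k)) (nonsmooth_cost_in _ _ (Xxs k)).
  rewrite -!EFinD !lee_fin yE => xle.
  have := sL k; move: xle; rewrite /s smooth_costE => xle sLk.
  have := proximal_gradient_step sLk alpha0 alphaL xle.
  have := ler_wpM2l a0 (XD _ _ (Xxs k) (Xx k.-1)).
  rewrite -/C; lra.
have regC k : (regret f x xstar k <= (k%:R * C)%:E)%E.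
  rewrite /regret.
  apply: (@le_trans _ _ (\sum_(1 <= i < k.+1) C%:E)%E).
    by rewrite !big_nat; apply: lee_sum => i /andP[i1 _]; exact: step.
  by rewrite sumEFin sumr_const_nat subn1 mulr_natl.
apply: (@bounded_bigO_seq _ _ _ C) => // k.
  (* At k = 0 the average is 0, by the convention that 0 has inverse 0. *)
  case: k => [|k]; first by rewrite invr0 mul0e lee_fin.
  apply: (@le_trans _ _ ((k.+1%:R^-1)%:E * (k.+1%:R * C)%:E)%E).
    by apply: lee_wpmul2l => //; rewrite lee_fin invr_ge0.
  by rewrite -EFinM lee_fin mulKf.
have k0 : 0 <= k%:R^-1 :> R by rewrite invr_ge0.
rewrite -addrA lerDl addr_ge0// mulr_ge0// sumr_ge0// => i _.
  exact: norm2_ge0.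
exact: sqr_ge0.
Qed.
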